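(* Let $a>0$ be a fixed real number. Let $\mathbb{X}=(X_n,n\ge 1)$ be a strictly stationary sequence of random variables on a probability space $(\Omega,\mathcal{F},\mathbb{P})$ and let $(k_n,n\ge1)$ be a sequence of integers with $1\le k_n\le n$ for all $n$ and $\lim_{n\to\infty}k_n/n=1$. Assume that $$\mathbb{P}\big(X_1=\gamma_1(X_1|\mathcal{I}^{\mathbb{X}})\big)=0\quad\text{and}\quad\mathbb{P}\big(X_1=\gamma_1(X_1|\mathcal{I}^{\mathbb{X}})-a\big)=0.$$ Then, as $n\to\infty$, $$\frac{K^{\mathbb{X}}(k_n,n,a)}{n}\longrightarrow\mathbb{P}\big(X_1>\gamma_1(X_1|\mathcal{I}^{\mathbb{X}})-a\,\big|\,\mathcal{I}^{\mathbb{X}}\big)\quad\mathbb{P}\text{-almost surely}.$$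
   Context: $\mathcal{I}^{\mathbb{X}}$ is the sigma-field of sets invariant with respect to $\mathbb{X}$, i.e. of all $A\subseteq\Omega$ for which there is a Borel set $B\in\mathcal{B}(\mathbb{R}^{\mathbb{N}})$ with $A=\{\omega\in\Omega:(X_i(\omega),X_{i+1}(\omega),\ldots)\in B\}$ for every $i\ge1$. An extended random variable is a measurable function with values in $[-\infty,\infty]$; the usual conventions $x\pm\infty=\pm\infty$, $x<\infty$ for $x\in\mathbb{R}$ apply. For a (real-valued) random variable $X$ on $(\Omega,\mathcal{F},\mathbb{P})$ and a sigma-field $\mathcal{G}\subseteq\mathcal{F}$, the conditional right endpoint of the support of $X$ given $\mathcal{G}$, denoted $\gamma_1(X|\mathcal{G})$, is an extended random variable $\underline{Q}_1$ such that (i) $\underline{Q}_1$ is $\mathcal{G}$-measurable; (ii) $\mathbb{P}(X\le\underline{Q}_1|\mathcal{G})=1$ a.s.; (iii) for any $\mathcal{G}$-measurable extended random variable $Q_1$ with $\mathbb{P}(X\le Q_1|\mathcal{G})=1$ a.s., one has $Q_1\ge\underline{Q}_1$ a.s. It exists and is unique up to almost sure equality. $X_{1:n}\le\cdots\le X_{n:n}$ are the order statistics of $X_1,\ldots,X_n$, and $K^{\mathbb{X}}(k_n,n,a)=\sum_{i=1}^n I(X_{k_n:n}-a<X_i<X_{k_n:n})$, where $I(\cdot)$ is the indicator function. *)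

(* Defs.v *)
From HB Require Import structures.
From mathcomp Require Import all_boot all_order all_algebra.
From mathcomp Require Import all_classical all_reals all_analysis.
From mathcomp Require Import measurable_realfun.
Import Order.TTheory GRing.Theory Num.Theory.
Import numFieldNormedType.Exports.

Set Implicit Arguments.
Unset Strict Implicit.
Unset Printing Implicit Defensive.

Local Open Scope classical_set_scope.
Local Open Scope ring_scope.

(* Processes are indexed from 0: [X i] stands for X_{i+1}, hence [tail X i w]
   is (X_{i+1}(w), X_{i+2}(w), ...) and [tail X 0 w] is the whole trajectory. *)

Definition borel_RN (R : realType) : set (set (nat -> R)) :=
  <<s [set U : set {ptws nat -> R} | open U] >>.

Definition tail (T : Type) (R : realType) (X : nat -> T -> R) (i : nat) (w : T)
  : nat -> R := fun j => X (i + j)%N w.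

Definition strictly_stationary d (T : measurableType d) (R : realType)
    (P : probability T R) (X : nat -> T -> R) : Prop :=
  forall (i : nat) (B : set (nat -> R)), borel_RN B ->
    P (tail X i @^-1` B) = P (tail X 0 @^-1` B).

Definition invariant_sets (T : Type) (R : realType) (X : nat -> T -> R)
  : set (set T) :=
  [set A | exists2 B, borel_RN B & forall i, A = tail X i @^-1` B].

(* Hence <<s invariant_sets X>> = invariant_sets X, and measurability from
   [g_sigma_algebraType (invariant_sets X)] is measurability with respect to
   the invariant sigma-field itself. *)
Lemma sigma_algebra_invariant_sets (T : Type) (R : realType)
  (X : nat -> T -> R) : sigma_algebra setT (invariant_sets X).
Proof.
have [b0 bD bU] := smallest_sigma_algebra setT
  [set U : set {ptws nat -> R} | open U].
split.
- by exists set0 => // i; rewrite preimage_set0.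
- move=> A [B mB AB]; exists (setT `\` B); first exact: bD.
  by move=> i; rewrite (AB i) !setTD preimage_setC.
- move=> A /(_ _)/cid2-/all_sig2[B mB AB].
  exists (\bigcup_n B n); first exact: bU.
  by move=> i; rewrite preimage_bigcup; apply: eq_bigcupr => n _; exact: AB.
Qed.

Definition measurable_wrt (T : pointedType) d' (U : measurableType d')
    (G : set (set T)) (f : T -> U) : Prop :=
  measurable_fun [set: g_sigma_algebraType G] (f : g_sigma_algebraType G -> U).

(* [f] is a version of the conditional probability P(A | G). *)
Definition is_cond_prob d (T : measurableType d) (R : realType)
    (P : probability T R) (G : set (set T)) (A : set T) (f : T -> R) : Prop :=
  [/\ measurable_wrt G f,
      P.-integrable [set: T] (EFin \o f) &
      forall C, G C -> (\int[P]_(w in C) (f w)%:E)%E = P (A `&` C)].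

(* P(A | G) = 1 almost surely. *)
Definition cond_prob_eq1 d (T : measurableType d) (R : realType)
    (P : probability T R) (G : set (set T)) (A : set T) : Prop :=
  exists2 f, is_cond_prob P G A f & {ae P, forall w, f w = 1}.

(* [Q] is a version of gamma_1(Y | G). *)
Definition is_cond_right_endpoint d (T : measurableType d) (R : realType)
    (P : probability T R) (G : set (set T)) (Y : T -> R) (Q : T -> \bar R)
  : Prop :=
  [/\ measurable_wrt G Q,
      cond_prob_eq1 P G [set w | ((Y w)%:E <= Q w)%E] &
      forall Q1 : T -> \bar R, measurable_wrt G Q1 ->
        cond_prob_eq1 P G [set w | ((Y w)%:E <= Q1 w)%E] ->
        {ae P, forall w, (Q w <= Q1 w)%E}].

(* The [k]-th smallest, 1 <= k <= n, of the n values x 0, ..., x (n - 1). *)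
Definition order_stat (R : realType) (x : nat -> R) (k n : nat) : R :=
  nth 0 (sort <=%R [seq x i | i <- iota 0 n]) k.-1.

Definition near_count (R : realType) (x : nat -> R) (k n : nat) (a : R) : nat :=
  (\sum_(i < n) (order_stat x k n - a < x i < order_stat x k n)%R)%N.

(* Main.v *)
Require Import Defs.
From HB Require Import structures.
From mathcomp Require Import all_boot all_order all_algebra.
From mathcomp Require Import all_classical all_reals all_analysis.
From mathcomp Require Import measurable_realfun.
From mathcomp Require Import lra.
Import Order.TTheory GRing.Theory Num.Theory.
Import numFieldNormedType.Exports.

(** The upper bound [Q] is not attained almost surely, so every [X i] lies
    strictly below [Q]. For a threshold [q < Q] measurable with respect to the
    invariant sigma-field, the indices [i] with [X i > q] have positive lower
    density, whereas only [n - k n = o(n)] of the first [n] values exceed the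
    order statistic; hence the order statistic [v] eventually exceeds every such
    [q], and it stays below [Q]. Therefore the number of [X i] in [(v - a, v)]
    is at most the number of [X i > q - a], and at least the number of
    [X i > Q - a] minus the number of [X i > q]. As [q] increases to [Q], the
    events [X i > q - a] and [X i > q] decrease to [X i >= Q - a] and
    [X i >= Q], which by the two hypotheses differ from [X i > Q - a] and from
    the empty event by null sets. So the pointwise ergodic theorem closes the
    gap between the two bounds ([near_count_cvg]).

    The ergodic theorem enters in a form adapted to this use. A set of paths [E]
    turns into events [tail X i @^-1` E], and [visits E n] counts those that
    occur among the first [n]. The maximal ergodic inequality
    ([maximal_ergodic]) states that an invariant set on which the proportion of
    visits to [E] exceeds [c] at some time meets the event [E] in at least a
    fraction [c] of its probability. It yields, directly for the given version
    of the conditional probability, an upper bound on the upper density of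
    visits, uniform along decreasing sequences of events
    ([eventually_visits_le]); the bound from below comes from the complementary
    events. It also yields the positive lower density
    ([frequently_above_threshold]): on the invariant set where the lower density
    of [X i > q] is 0, [X 0 <= q] almost surely, so replacing [Q] by [q] there
    would contradict the minimality of [Q].

    Thresholds such as [Q - a] are random, but being invariant they do not
    change along the path, so all the events in play are described by Borel
    sets of paths ([borel_threshold]). *)

Set Implicit Arguments.
Unset Strict Implicit.
Unset Printing Implicit Defensive.

Local Open Scope classical_set_scope.
Local Open Scope ring_scope.

(** * Path space *)

Definition path_space (R : realType) :=
  g_sigma_algebraType [set U : set {ptws nat -> R} | open U].

Definition shift (R : realType) (x : nat -> R) : nat -> R := fun j => x j.+1.

Definition rat_box (R : realType) (b : seq (rat * rat)) : set (nat -> R) :=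
  [set x | forall j, (j < size b)%N ->
     ratr (nth (0, 0) b j).1 < x j < ratr (nth (0, 0) b j).2].

(** Otherwise, boxes of length [n] and radius [1 / (n + 1)] around [x] would
    each contain a point outside [U]; these points converge to [x]
    coordinatewise, hence in the product topology, so they end up in [U]. *)
Lemma open_rat_box (R : realType) (U : set {ptws nat -> R}) (x : nat -> R) :
  open U -> U x -> exists2 b, rat_box b x & rat_box b `<=` U.
Proof.
move=> oU Ux.
have qex (nj : nat * nat) : exists q : rat * rat,
    [/\ x nj.2 - nj.1.+1%:R^-1 < ratr q.1, ratr q.1 < x nj.2,
        x nj.2 < ratr q.2 & ratr q.2 < x nj.2 + nj.1.+1%:R^-1].
  case: nj => n j /=.
  have : 0 < n.+1%:R^-1 :> R by rewrite invr_gt0.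
  move: n.+1%:R^-1 => e e0.
  have /rat_in_itvoo[q1] : x j - e < x j by lra.
  have /rat_in_itvoo[q2] : x j < x j + e by lra.
  rewrite !in_itv /= => /andP[h1 h2] /andP[h3 h4].
  by exists (q1, q2).
have [q qP] := choice qex.
pose b n := mkseq (fun j => q (n, j)) n.
have bx n : rat_box (b n) x.
  move=> j; rewrite size_mkseq => jn; rewrite nth_mkseq//.
  by have [_ -> -> _] := qP (n, j).
apply: contrapT => noU.
have yex (n : nat) : exists y, rat_box (b n) y /\ ~ U y.
  apply: contrapT => noy; apply: noU; exists (b n) => // y by_.
  by apply: contrapT => Uy; apply: noy; exists y.
have [y yP] := choice yex.
have yx t : y n t @[n --> \oo] --> x t.
  apply/cvgrPdist_lt => e e0.
  near=> n.
  have tn : (t < n)%N by near: n; exists t.+1.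
  have ne : n.+1%:R^-1 < e by near: n; exact: near_infty_natSinv_lt (PosNum e0).
  have /(_ t) := (yP n).1; rewrite size_mkseq nth_mkseq// => /(_ tn)/andP[? ?].
  have /= [h1 ? ? h4] := qP (n, t).
  move: (n.+1%:R^-1 : R) ne h1 h4 => r *.
  by rewrite ltr_norml; apply/andP; split; lra.
have yxU : {ptws, y @ \oo --> (x : nat -> R)} by apply/pointwise_cvgP => t; exact: yx.
have xU : nbhs (x : {ptws nat -> R}) U by exact: open_nbhs_nbhs.
have [N _ /(_ N (leqnn N))] := yxU _ xU.
by have [] := yP N.
Unshelve. all: by end_near. Qed.

(** The topology is countably generated: an open set is the union of the
    rational boxes that it contains, so its preimage is a countable union of
    finite intersections of events about single coordinates. *)
Lemma measurable_tail d (T : measurableType d) (R : realType)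
    (X : nat -> T -> R) (mX : forall i, measurable_fun [set: T] (X i)) i :
  measurable_fun [set: T] (tail X i : T -> path_space R).
Proof.
apply: measurability; [reflexivity|].
move=> _ [U oU <-]; rewrite setTI.
have -> : tail X i @^-1` U =
    \bigcup_b (tail X i @^-1` (if `[< @rat_box R b `<=` U >] then rat_box b
                              else set0)).
  rewrite -preimage_bigcup; congr (_ @^-1` _); apply/seteqP; split.
    by move=> x /(open_rat_box oU)[b bx bU]; exists b => //; case: asboolP.
  by move=> x [b _]; case: asboolP => // bU /bU.
apply: countable_bigcupT_measurable => // b.
case: asboolP => _; last by rewrite preimage_set0.
have -> : tail X i @^-1` rat_box b =
    \bigcap_(j in [set j | (j < size b)%N])
      (X (i + j)%N @^-1` `]ratr (nth (0, 0) b j).1, ratr (nth (0, 0) b j).2[).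
  apply/seteqP; split=> w h j /= jb; first by rewrite in_itv; exact: h.
  by have := h j jb; rewrite /= in_itv.
apply: bigcap_measurableType => j _.
by rewrite -[X in measurable X]setTI; exact: mX.
Qed.

Lemma measurable_coord (R : realType) (j : nat) :
  measurable_fun [set: path_space R] ((fun x => x j) : path_space R -> R).
Proof.
move=> mT; apply: (measurability _ (RGenOpens.measurableE R)) => //.
move=> _ [_ [u [v ->]] <-]; rewrite setTI.
apply: sub_sigma_algebra => /=.
apply: open_comp; last exact: interval_open.
by move=> x _; exact: proj_continuous.
Qed.

(** The coordinates form a process on the path space itself, and the shift is
    one of its tails. *)
Lemma measurable_shift (R : realType) :
  measurable_fun [set: path_space R] (@shift R : path_space R -> path_space R).
Proof. exact: (measurable_tail (@measurable_coord R) 1%N). Qed.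

Lemma borel_preimage (R : realType) d (U : measurableType d)
    (f : path_space R -> U) (Y : set U) :
  measurable_fun [set: path_space R] f -> measurable Y ->
  borel_RN (f @^-1` Y).
Proof. by move=> mf mY; have := mf measurableT _ mY; rewrite setTI. Qed.

(** * The maximal ergodic inequality *)

Fixpoint visits (R : realType) (E : set (nat -> R)) (n : nat) (x : nat -> R)
    : nat :=
  if n is m.+1 then ((x \in E) + visits E m (shift x))%N else 0%N.

(** The maximum over [m <= n] of [visits E m x - c * m], in the recursive form
    on which the comparison [max_excess_step] rests. *)
Fixpoint max_excess (R : realType) (E : set (nat -> R)) (c : R) (n : nat)
    (x : nat -> R) : R :=
  if n is m.+1 then
    Num.max 0 ((x \in E)%:R - c + max_excess E c m (shift x))
  else 0.

Section max_excess.
Context (R : realType) (E : set (nat -> R)) (c : R).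
Local Notation visits := (visits E).
Local Notation max_excess := (max_excess E c).

Lemma measurable_visits n : borel_RN E ->
  measurable_fun [set: path_space R] ((fun x => (visits n x)%:R) : path_space R -> R).
Proof.
move=> mE; elim: n => [|n IHn]; first exact: measurable_cst.
have -> : (fun x => (visits n.+1 x)%:R) =
    (\1_E : path_space R -> R) \+ ((fun x => (visits n x)%:R) \o @shift R).
  by apply/funext => x /=; rewrite natrD indicE.
apply: measurable_funD; first exact: measurable_indic.
exact: measurableT_comp IHn (@measurable_shift R).
Qed.

Lemma measurable_max_excess n : borel_RN E ->
  measurable_fun [set: path_space R] (max_excess n : path_space R -> R).
Proof.
move=> mE; elim: n => [|n IHn]; first exact: measurable_cst.
have -> : max_excess n.+1 =
    (cst 0 : path_space R -> R) \max
     (((\1_E : path_space R -> R) \- cst c) \+ (max_excess n \o @shift R)).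
  by apply/funext => x /=; rewrite indicE.
apply: measurable_maxr; first exact: measurable_cst.
apply: measurable_funD; last exact: measurableT_comp IHn (@measurable_shift R).
by apply: measurable_funB; [exact: measurable_indic|exact: measurable_cst].
Qed.

Lemma max_excess_ge0 n x : 0 <= max_excess n x.
Proof. by case: n => [//|n /=]; rewrite le_max lexx. Qed.

Lemma max_excess_leS n x : max_excess n x <= max_excess n.+1 x.
Proof.
elim: n x => [|n IHn] x; first exact: max_excess_ge0.
by rewrite [leLHS]/= [leRHS]/= ge_max !le_max lexx/= lerD2l IHn orbT.
Qed.

Lemma max_excess_le n x : 0 <= c -> max_excess n x <= n%:R.
Proof.
move=> c0; elim: n x => [//|n IHn] x /=.
rewrite ge_max ler0n/= -natr1 addrC lerD//.
by case: (x \in E) => /=; lra.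
Qed.

Lemma visits_le_max_excess n x : (visits n x)%:R - c * n%:R <= max_excess n x.
Proof.
elim: n x => [|n IHn] x /=; first by rewrite mulr0 subrr.
rewrite le_max; apply/orP; right; have := IHn (shift x).
by rewrite natrD -natr1 mulrDr mulr1; lra.
Qed.

(** A positive maximum is attained after at least one step, so it splits into
    the first step and the excess accumulated by the shifted path. *)
Lemma max_excess_step n x :
  max_excess n.+1 x + c * (0 < max_excess n.+1 x)%R%:R
  <= ((x \in E) && (0 < max_excess n.+1 x)%R)%:R + max_excess n (shift x).
Proof.
have h0 := max_excess_ge0 n (shift x).
have [h|h] := boolP (0 < max_excess n.+1 x); last first.
  by rewrite andbF mulr0 addr0 add0r (le_trans _ h0)// leNgt.
rewrite andbT mulr1; move: h => /=; rewrite lt_max ltxx/=.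
by move=> /ltW/max_idPr ->; lra.
Qed.

End max_excess.

Section stationary.
Context d (T : measurableType d) (R : realType) (P : probability T R).
Variable X : nat -> T -> R.
Hypothesis mX : forall i, measurable_fun [set: T] (X i).
Hypothesis statX : strictly_stationary P X.

Lemma shift_tail i w : shift (tail X i w) = tail X i.+1 w.
Proof. by apply/funext => j; rewrite /shift /tail addSnnS. Qed.

Lemma measurable_preimage_tail i (B : set (nat -> R)) :
  borel_RN B -> measurable (tail X i @^-1` B).
Proof. by move=> mB; rewrite -[X in measurable X]setTI; exact: measurable_tail. Qed.

Lemma measurable_invariant C : invariant_sets X C -> measurable C.
Proof. by case=> B mB /(_ 0%N) ->; exact: measurable_preimage_tail. Qed.

(** An invariant set is the preimage of one and the same [B] under all tails, so
    stationarity still holds after restriction to it. *)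
Lemma integral_tail_invariant (f : path_space R -> R) C i :
  invariant_sets X C -> measurable_fun [set: path_space R] f ->
  (forall x, 0 <= f x) ->
  (\int[P]_(w in C) (f (tail X i w))%:E = \int[P]_(w in C) (f (tail X 0 w))%:E)%E.
Proof.
move=> [B mB CB] mf f0.
have mBf : measurable_fun (B : set (path_space R)) (EFin \o f).
  by apply/measurable_EFinP; exact: measurable_funS mf.
transitivity (\int[pushforward P (tail X i : T -> path_space R)]_(x in B) (f x)%:E)%E.
  rewrite ge0_integral_pushforward//; first by rewrite -CB.
  - exact: measurable_tail.
  - by move=> x _; rewrite lee_fin.
transitivity (\int[pushforward P (tail X 0 : T -> path_space R)]_(x in B) (f x)%:E)%E.
  apply: eq_measure_integral; [exact: measurable_tail..|].
  by move=> mTi mT0 A mA _; exact: statX.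
rewrite [RHS](_ : _ = (\int[P]_(w in tail X 0 @^-1` B) (f (tail X 0 w))%:E)%E);
  last by rewrite -CB.
rewrite ge0_integral_pushforward//.
- exact: measurable_tail.
- by move=> x _; rewrite lee_fin.
Qed.

(** Integrating [max_excess_step] over the invariant set [C], the two integrals
    of the maximal excess cancel by stationarity, up to monotonicity in [n]. *)
Lemma maximal_ergodic_step (E : set (nat -> R)) (C : set T) (c : R) (n : nat) :
  borel_RN E -> invariant_sets X C -> 0 <= c ->
  (c%:E * P (C `&` [set w | (0 < max_excess E c n.+1 (tail X 0 w))%R])
   <= P (tail X 0 @^-1` E `&` C))%E.
Proof.
move=> mE IC c0; have mC := measurable_invariant IC.
pose D := [set x | 0 < max_excess E c n.+1 x].
have mD : borel_RN D.
  rewrite (_ : D = max_excess E c n.+1 @^-1` `]0, +oo[); last first.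
    by apply/seteqP; split => x; rewrite /D /= in_itv/= andbT.
  by apply: borel_preimage => //; exact: measurable_max_excess.
pose S := tail X 0 @^-1` D; pose F := tail X 0 @^-1` (E `&` D).
have mS : measurable S by exact: measurable_preimage_tail.
have mF : measurable F.
  by apply: measurable_preimage_tail; exact: (@measurableI _ (path_space R)).
have mh m i : measurable_fun C (fun w => (max_excess E c m (tail X i w))%:E).
  apply/measurable_EFinP; apply: (measurable_funS measurableT) => //.
  exact: (measurableT_comp (measurable_max_excess c m mE) (measurable_tail mX i)).
have h0 m i w : C w -> (0 <= (max_excess E c m (tail X i w))%:E)%E.
  by move=> _; rewrite lee_fin max_excess_ge0.
have mi A : measurable A -> measurable_fun C (fun w => (\1_A w : R)%:E).
  by move=> mA; apply/measurable_EFinP; exact: measurable_indic.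
have step : (\int[P]_(w in C) ((max_excess E c n.+1 (tail X 0 w))%:E + c%:E * (\1_S w)%:E) <=
   \int[P]_(w in C) ((\1_F w)%:E + (max_excess E c n (tail X 1 w))%:E))%E.
  apply: ge0_le_integral => //.
  - move=> w Cw; apply: adde_ge0; [exact: h0|].
    by rewrite -EFinM lee_fin mulr_ge0.
  - by apply: emeasurable_funD => //; apply: measurable_funeM; exact: mi.
  - by apply: emeasurable_funD => //; exact: mi.
  - move=> w _; rewrite -EFinM -!EFinD lee_fin -shift_tail.
    have := max_excess_step E c n (tail X 0 w); rewrite !indicE.
    suff -> : (w \in F) = (tail X 0 w \in E) && (0 < max_excess E c n.+1 (tail X 0 w)).
      suff -> : (w \in S) = (0 < max_excess E c n.+1 (tail X 0 w)) by [].
      by apply/idP/idP; rewrite inE.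
    by apply/idP/andP; rewrite !inE.
pose I := (\int[P]_(w in C) (max_excess E c n.+1 (tail X 0 w))%:E)%E.
have Ifin : I \is a fin_num.
  rewrite ge0_fin_numE; last by apply: integral_ge0; exact: h0.
  rewrite (@le_lt_trans _ _ (\int[P]_(w in C) (cst n.+1%:R%:E) w)%E)//.
    apply: ge0_le_integral => //; first exact: h0.
    by move=> w _; rewrite lee_fin max_excess_le.
  by rewrite integral_cst// lte_mul_pinfty// (le_lt_trans (probability_le1 _ _))// ltry.
have Ile : (\int[P]_(w in C) (max_excess E c n (tail X 0 w))%:E <= I)%E.
  apply: ge0_le_integral => //; first exact: h0.
  by move=> w _; rewrite lee_fin max_excess_leS.
have cS0 w : C w -> (0 <= c%:E * (\1_S w)%:E)%E.
  by move=> _; rewrite -EFinM lee_fin mulr_ge0.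
move: step; rewrite !ge0_integralD//; last 4 first.
- exact: mi.
- exact: h0.
- exact: h0.
- by apply: measurable_funeM; exact: mi.
rewrite ge0_integralZl//; [|exact: mi].
rewrite !integral_indic// (@integral_tail_invariant (max_excess E c n)) //; last 2 first.
- exact: measurable_max_excess.
- exact: max_excess_ge0.
rewrite -/I => step.
rewrite [C `&` _]setIC.
have {step} := le_trans step (leeD2l _ Ile).
rewrite addeC leeD2rE// => /le_trans; apply.
apply: le_measure; rewrite ?inE.
- exact: measurableI.
- by apply: measurableI => //; exact: measurable_preimage_tail.
- by apply: setSI => w [].
Qed.

(** The sets of [maximal_ergodic_step] increase to [C] with [n]. *)
Lemma maximal_ergodic (E : set (nat -> R)) (C : set T) (c : R) :
  borel_RN E -> invariant_sets X C ->
  (forall w, C w -> exists n, c * n%:R < (visits E n (tail X 0 w))%:R) ->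
  (c%:E * P C <= P (tail X 0 @^-1` E `&` C))%E.
Proof.
move=> mE IC Cvis; have mC := measurable_invariant IC.
(* For negative [c] the left-hand side is nonpositive. *)
have [c0|c0] := leP 0 c; last first.
  by rewrite (@le_trans _ _ 0%E)// mule_le0_ge0// lee_fin ltW.
pose D n := C `&` [set w | 0 < max_excess E c n.+1 (tail X 0 w)].
have CD : C = \bigcup_n D n.
  apply/seteqP; split=> [w Cw|w [n _ []]//].
  have [n cn] := Cvis w Cw; exists n => //; split => //=.
  rewrite (lt_le_trans _ (max_excess_leS _ _ _ _))//.
  by rewrite (lt_le_trans _ (visits_le_max_excess _ _ _ _))// subr_gt0.
have mD n : measurable (D n).
  apply: measurableI => //.
  rewrite (_ : [set w | _] = tail X 0 @^-1` (max_excess E c n.+1 @^-1` `]0, +oo[)).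
    apply: measurable_preimage_tail; apply: borel_preimage => //.
    exact: measurable_max_excess.
  by apply/seteqP; split => w; rewrite /= in_itv/= andbT.
have PD : P (D n) @[n --> \oo] --> P C.
  rewrite CD; apply: nondecreasing_cvg_mu => //; first exact: bigcupT_measurable.
  apply/nondecreasing_seqP => n; apply/subsetPset => w [Cw h]; split => //.
  exact: lt_le_trans h (max_excess_leS _ _ _ _).
have {}PD : (c%:E * P (D n))%E @[n --> \oo] --> (c%:E * P C)%E by exact: cvgeZl.
rewrite -(cvg_lim _ PD)//; apply: lime_le; first by apply/cvg_ex; eexists; exact: PD.
by apply: nearW => n; exact: maximal_ergodic_step.
Qed.

End stationary.

(** * Upper densities of visits *)

(** [x] belongs to it when the limit superior of [visits E n x / n] exceeds [c]:
    the margin [1 / (j + 1)] makes the set invariant under the shift, and as it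
    ranges over a countable set, measurability is preserved. *)
Definition upper_dense (R : realType) (E : set (nat -> R)) (c : R)
    : set (nat -> R) :=
  \bigcup_j \bigcap_N \bigcup_(n in [set n | (N <= n)%N])
    [set x | (c + j.+1%:R^-1) * n%:R <= (visits E n x)%:R].

Lemma borel_upper_dense (R : realType) (E : set (nat -> R)) (c : R) :
  borel_RN E -> borel_RN (upper_dense E c).
Proof.
move=> mE; rewrite /upper_dense.
apply: (@bigcupT_measurable _ (path_space R)) => j.
apply: (@bigcapT_measurable _ (path_space R)) => N.
apply: (@bigcup_measurable _ (path_space R)) => n _.
rewrite (_ : [set x | _] = (fun x => (visits E n x)%:R) @^-1` `[(c + j.+1%:R^-1) * n%:R, +oo[).
  by apply: borel_preimage => //; exact: measurable_visits.
by apply/seteqP; split => x; rewrite /= in_itv/= andbT.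
Qed.

Lemma not_upper_dense (R : realType) (E : set (nat -> R)) (c e : R) x :
  0 < e -> ~ upper_dense E c x ->
  \forall n \near \oo, (visits E n x)%:R <= (c + e) * n%:R.
Proof.
move=> e0 ud.
have [j je] : exists j : nat, j.+1%:R^-1 < e.
  have [N _ /(_ N (leqnn N))] := near_infty_natSinv_lt (PosNum e0).
  by exists N.
apply: contrapT => nn; apply: ud; exists j => // N _.
apply: contrapT => nN; apply: nn; exists N => // n /= Nn.
rewrite leNgt; apply/negP => h; apply: nN; exists n => //=.
apply/ltW/(le_lt_trans _ h); by rewrite ler_wpM2r// lerD2l ltW.
Qed.

(** One step of the shift moves the number of visits and the number of steps by
    at most one, which half of the margin absorbs for large [n]. *)
Lemma upper_dense_shift (R : realType) (E : set (nat -> R)) (c : R) x :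
  upper_dense E c (shift x) <-> upper_dense E c x.
Proof.
have half j : exists2 r : R, j.+1%:R^-1 = r + r & r = (j.*2.+1).+1%:R^-1.
  exists (j.*2.+1).+1%:R^-1 => //.
  by rewrite -doubleS -muln2 natrM invfM -splitr.
have big (r : R) : 0 < r -> exists K, forall n, (K <= n)%N -> `|c| + 2 <= r * n%:R.
  move=> r0; exists (Num.bound ((`|c| + 2) / r)) => n.
  rewrite -(ler_nat R) => Kn; rewrite mulrC -ler_pdivrMr//.
  by apply/ltW/(lt_le_trans _ Kn); rewrite archi_boundP// divr_ge0// ltW.
split=> -[j _ jP]; exists j.*2.+1 => // N _; have [r jr rE] := half j; rewrite -rE.
- have r0 : 0 < r by rewrite rE invr_gt0.
  have r1 : r <= 1 by rewrite rE invf_le1// ler1n.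
  have [K KP] := big r r0.
  have [n] := jP (maxn N K) I; rewrite /= jr geq_max => /andP[Nn Kn] vn.
  exists n.+1; first by rewrite /= (leq_trans Nn).
  have := KP n Kn; have := ler_norm c; rewrite /= natrD -natr1.
  have : 0 <= (x \in E)%:R :> R by [].
  by lra.
- have r0 : 0 < r by rewrite rE invr_gt0.
  have [K KP] := big r r0.
  have [[//|n]] := jP (maxn N K).+1 I; rewrite /= jr ltnS geq_max => /andP[Nn Kn].
  rewrite natrD -natr1 => vn.
  exists n => //=.
  have := KP n Kn; have := ler_norm (- c); rewrite normrN.
  have : (x \in E)%:R <= 1 :> R by case: (x \in E).
  by lra.
Qed.

Lemma ae_forall_countable d (T : measurableType d) (R : realType)
    (mu : {measure set T -> \bar R}) (I : countType) (Phi : I -> T -> Prop) :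
  (forall i, {ae mu, forall w, Phi i w}) -> {ae mu, forall w i, Phi i w}.
Proof.
move=> h; have : {ae mu, forall w n, if unpickle n is Some i then Phi i w else True}.
  apply: ae_foralln => n; case: unpickle => [i|]; first exact: h.
  by apply: filterE.
by apply: filterS => w hw i; have := hw (pickle i); rewrite pickleK.
Qed.

Section density.
Context d (T : measurableType d) (R : realType) (P : probability T R).
Variable X : nat -> T -> R.
Hypothesis mX : forall i, measurable_fun [set: T] (X i).
Hypothesis statX : strictly_stationary P X.

Definition invariant_space := g_sigma_algebraType (invariant_sets X).

Lemma invariantE (C : set T) :
  invariant_sets X C = measurable (C : set invariant_space).
Proof.
rewrite [RHS](_ : _ = <<s invariant_sets X>> C)//.
by rewrite sigma_algebra_id//; exact: sigma_algebra_invariant_sets.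
Qed.

Lemma invariant_upper_dense (E : set (nat -> R)) (c : R) :
  borel_RN E -> invariant_sets X (tail X 0 @^-1` upper_dense E c).
Proof.
move=> mE; exists (upper_dense E c); first exact: borel_upper_dense.
elim=> // i ->; apply/seteqP; split => w /=; rewrite -shift_tail.
  exact: (upper_dense_shift E c _).2.
exact: (upper_dense_shift E c _).1.
Qed.

Lemma upper_dense_prob (E : set (nat -> R)) (c : R) (C : set T) :
  borel_RN E -> invariant_sets X C -> C `<=` tail X 0 @^-1` upper_dense E c ->
  (c%:E * P C <= P (tail X 0 @^-1` E `&` C))%E.
Proof.
move=> mE IC CE; apply: (maximal_ergodic mX statX) => // w /CE[j _ /(_ 1%N I)[n n1 nE]].
exists n; apply: lt_le_trans nE; rewrite mulrDl ltrDl mulr_gt0// ltr0n.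
exact: n1.
Qed.

(** Half of the ergodic theorem, uniformly along a decreasing sequence of
    events: were the upper density of every [E m] above [c] on an invariant set
    where [p < b < c], the maximal inequality would give that set an
    intersection with the limit event of probability at least [c], in place of
    at most [b], times its own. *)
Lemma eventually_visits_le (E : nat -> set (nat -> R)) (p : T -> R) :
  (forall m, borel_RN (E m)) ->
  (forall m, tail X 0 @^-1` E m.+1 `<=` tail X 0 @^-1` E m) ->
  is_cond_prob P (invariant_sets X) (tail X 0 @^-1` \bigcap_m E m) p ->
  {ae P, forall w, forall e : R, 0 < e -> exists m,
    \forall n \near \oo, (visits (E m) n (tail X 0 w))%:R <= (p w + e) * n%:R}.
Proof.
move=> mE dE [mp ip pE].
(* [W (b, c)]: [p < b], yet the upper density of every [E m] exceeds [c]. *)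
pose W (q : rat * rat) : set T := p @^-1` `]-oo, ratr q.1[%classic `&`
   \bigcap_m tail X 0 @^-1` upper_dense (E m) (ratr q.2).
have IW q : invariant_sets X (W q).
  rewrite invariantE; apply: (@measurableI _ invariant_space).
    by rewrite -[X in measurable X](setTI (_ : set invariant_space)); exact: mp.
  apply: (@bigcapT_measurable _ invariant_space) => m.
  by rewrite -invariantE; exact: invariant_upper_dense.
have PW q : (ratr q.1 : R) < ratr q.2 -> P (W q) = 0%E.
  move=> q12; have mW := measurable_invariant mX (IW q).
  have : (((ratr q.2)%:E * P (W q)) <= (ratr q.1)%:E * P (W q))%E.
    have -> : ((ratr q.1)%:E * P (W q) = \int[P]_(w in W q) (cst (ratr q.1)%:E) w)%E.
      by rewrite integral_cst.
    apply: (@le_trans _ _ (\int[P]_(w in W q) (p w)%:E)%E); last first.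
      apply: le_integral => //.
      - exact: integrableS ip.
      - by apply: finite_measure_integrable_cst.
      - by move=> w; rewrite inE => -[/= + _]; rewrite in_itv/= lee_fin => /ltW.
    rewrite (pE _ (IW q)).
    pose F m := tail X 0 @^-1` E m `&` W q.
    have mF m : measurable (F m) by apply: measurableI => //; exact: measurable_preimage_tail.
    have FE : tail X 0 @^-1` (\bigcap_m E m) `&` W q = \bigcap_m F m.
      rewrite preimage_bigcap; apply/seteqP; split=> w.
        by move=> [Ew Ww] m _; split=> //; exact: Ew.
      move=> Fw; split=> [m _|]; first exact: (Fw m I).1.
      exact: (Fw 0%N I).2.
    have PF : P (F m) @[m --> \oo] --> P (\bigcap_m F m).
      apply: nonincreasing_cvg_mu => //.
      - by rewrite (le_lt_trans (probability_le1 _ _))// ltry.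
      - exact: bigcapT_measurable.
      - by apply/nonincreasing_seqP => m; apply/subsetPset; exact: setSI (dE m).
    rewrite FE -(cvg_lim _ PF)//; apply: lime_ge; first by apply/cvg_ex; eexists; exact: PF.
    apply: nearW => m; apply: upper_dense_prob => // w [_]; exact.
  have : (0 <= P (W q))%E by [].
  have [r Pr] : exists r, P (W q) = r%:E.
    by exists (fine (P (W q))); rewrite fineK// fin_num_measure.
  rewrite Pr.
  rewrite -!EFinM !lee_fin le_eqVlt => /predU1P[<-//|r0].
  by rewrite ler_pM2r// leNgt q12.
have : {ae P, forall w q, (ratr q.1 : R) < ratr q.2 -> ~ W q w}.
  apply: ae_forall_countable => q.
  apply: negligibleS (_ : P.-negligible
    (if (ratr q.1 : R) < ratr q.2 then W q else set0)).
    move=> w /= /not_implyP[->] /contrapT; exact.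
  case: ifPn => q12; last exact: negligible_set0.
  by apply/negligibleP; [exact: measurable_invariant|exact: PW].
apply: filterS => w wW e e0.
have /rat_in_itvoo[q1] : p w < p w + e / 3 by lra.
have /rat_in_itvoo[q2] : p w + e / 3 < p w + e / 2 by lra.
rewrite !in_itv/= => /andP[q2l q2r] /andP[q1l q1r].
have /existsNP[m Em] : ~ forall m, upper_dense (E m) (ratr q2) (tail X 0 w).
  move=> h; apply: (wW (q1, q2)) => /=; first lra.
  by split=> [|m _]; [rewrite /= in_itv|exact: h].
exists m; have e2 : 0 < e / 2 by lra.
apply: filterS (not_upper_dense e2 Em) => n /le_trans; apply.
by rewrite ler_wpM2r//; lra.
Qed.

End density.

(** * Events defined by an invariant threshold *)

Section threshold.
Context d (T : measurableType d) (R : realType) (P : probability T R).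
Variable X : nat -> T -> R.
Hypothesis mX : forall i, measurable_fun [set: T] (X i).

(** Although the threshold [f] is random, the events [f < X i] are all described
    by one Borel set of paths: separate [f w] from [X i w] by a rational number
    and use that [f] is invariant. *)
Lemma borel_threshold (f : T -> \bar R) : measurable_wrt (invariant_sets X) f ->
  exists2 E, borel_RN E &
    forall i, tail X i @^-1` E = [set w | (f w < (X i w)%:E)%E].
Proof.
move=> mf.
have Bex (q : rat) : exists B : set (nat -> R), borel_RN B /\
    forall i, f @^-1` `]-oo, (ratr q)%:E[ = tail X i @^-1` B.
  have : invariant_sets X (f @^-1` `]-oo, (ratr q)%:E[).
    rewrite invariantE -[X in measurable X](setTI (_ : set (invariant_space X))).
    by apply: mf => //; exact: emeasurable_itv.
  by move=> [B mB BE]; exists B.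
have [B BP] := choice Bex.
exists (\bigcup_q ([set x | ratr q < x 0%N] `&` B q)).
  apply: (@bigcupT_measurable_rat _ (path_space R)) => q.
  apply: (@measurableI _ (path_space R)); last exact: (BP q).1.
  rewrite (_ : [set x | _] = (fun x => x 0%N) @^-1` `]ratr q, +oo[).
    by apply: borel_preimage => //; exact: measurable_coord.
  by apply/seteqP; split => x; rewrite /= in_itv/= andbT.
move=> i; rewrite preimage_bigcup; apply/seteqP; split => w.
  move=> [q _ []]; rewrite /= {1}/tail addn0 => qX.
  have BE := (BP q).2 i => Bq; have : (tail X i @^-1` B q) w by [].
  by rewrite -BE /= in_itv/= => /lt_trans; apply; rewrite lte_fin.
move=> /= fX.
have [q /andP[fq qX]] : exists q : rat, (f w < (ratr q)%:E)%E && (ratr q < X i w).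
  move: fX; case: (f w) => [r| |]//.
    rewrite lte_fin => /rat_in_itvoo[q]; rewrite in_itv/= => /andP[rq qX].
    by exists q; rewrite lte_fin rq.
  have /rat_in_itvoo[q] : X i w - 1 < X i w by lra.
  by rewrite in_itv/= => /andP[rq qX] _; exists q; rewrite ltNyr.
exists q => //; split; first by rewrite /= /tail addn0.
have : (f @^-1` `]-oo, (ratr q)%:E[) w by rewrite /= in_itv.
by rewrite ((BP q).2 i).
Qed.

Lemma visits_tail (E : set (nat -> R)) n w :
  visits E n (tail X 0 w) = (\sum_(i < n) (tail X i w \in E))%N.
Proof.
suff h j : visits E n (tail X j w) = (\sum_(i < n) (tail X (j + i) w \in E))%N.
  by rewrite h.
elim: n j => [|n IHn] j; first by rewrite big_ord0.
rewrite big_ord_recl/= addn0 shift_tail IHn; congr addn.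
by apply: eq_bigr => i _; rewrite addSnnS.
Qed.

Lemma visits_threshold (f : T -> \bar R) (E : set (nat -> R)) n w :
  (forall i, tail X i @^-1` E = [set w | (f w < (X i w)%:E)%E]) ->
  visits E n (tail X 0 w) = (\sum_(i < n) (f w < (X i w)%:E)%E)%N.
Proof.
move=> EE; rewrite visits_tail; apply: eq_bigr => i _; congr nat_of_bool.
have -> : (tail X i w \in E) = (w \in tail X i @^-1` E) by [].
by rewrite EE; apply/idP/idP; rewrite inE.
Qed.

Lemma visits_setC (E : set (nat -> R)) n x :
  (visits E n x + visits (~` E) n x = n)%N.
Proof.
elim: n x => //= n IHn x; rewrite addnACA IHn.
by rewrite (_ : (x \in ~` E) = ~~ (x \in E)) ?in_setC//; case: (x \in E).
Qed.

(** * Versions of conditional probabilities *)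

Lemma is_cond_prob_setC A p : measurable A ->
  is_cond_prob P (invariant_sets X) A p ->
  is_cond_prob P (invariant_sets X) (~` A) (fun w => 1 - p w).
Proof.
move=> mA [mp ip pE].
have i1 : P.-integrable [set: T] (EFin \o (fun=> 1 : R)).
  exact: finite_measure_integrable_cst.
split.
- by apply: measurable_funB => //; exact: measurable_cst.
- exact: (integrableB measurableT i1 ip).
- move=> C IC; have mC := measurable_invariant mX IC.
  under eq_integral do rewrite EFinB.
  rewrite integralB_EFin//; [|exact: integrableS i1|exact: integrableS ip].
  rewrite (pE _ IC) [X in (X - _)%E](_ : _ = P C); last first.
    by rewrite -[LHS]/(\int[P]_(w in C) (cst 1%:E) w)%E integral_cst// mul1e.
  have -> : ~` A `&` C = C `\` A by rewrite setIC setDE.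
  have mAC := measurableI _ _ mA mC.
  rewrite measureD//; last by rewrite (le_lt_trans (probability_le1 _ _))// ltry.
  by rewrite setIC.
Qed.

Lemma is_cond_prob_null_superset A A' p : measurable A -> measurable A' ->
  A `<=` A' -> P (A' `\` A) = 0%E ->
  is_cond_prob P (invariant_sets X) A p ->
  is_cond_prob P (invariant_sets X) A' p.
Proof.
move=> mA mA' AA' AA'0 [mp ip pE]; split => // C IC; rewrite (pE _ IC).
have mC := measurable_invariant mX IC.
have -> : A' `&` C = (A `&` C) `|` ((A' `\` A) `&` C).
  by rewrite -setIUl setDUK.
have mD := measurableD mA' mA.
rewrite measureU0//; [exact: measurableI|exact: measurableI|].
by apply: subset_measure0 AA'0 => //; exact: measurableI.
Qed.

Lemma is_cond_prob_set0 : is_cond_prob P (invariant_sets X) set0 (fun=> 0).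
Proof.
split; first exact: measurable_cst.
- exact: finite_measure_integrable_cst.
- by move=> C _; rewrite integral0 set0I measure0.
Qed.

Lemma cond_prob_eq1P A : measurable A ->
  cond_prob_eq1 P (invariant_sets X) A <-> P A = 1%E.
Proof.
move=> mA; split=> [[f [mf fi fE] f1]|A1].
  have IT : invariant_sets X [set: T] by rewrite invariantE.
  rewrite -[A]setIT -(fE _ IT).
  rewrite (ae_eq_integral (cst 1%E))//.
  - by rewrite integral_cst// mul1e; exact: probability_setT.
  - exact: (measurable_int _ fi).
  - by apply: filterS f1 => w /= -> _.
exists (fun=> 1); last exact: filterE.
split; first exact: measurable_cst.
- exact: finite_measure_integrable_cst.
move=> C IC; have mC := measurable_invariant mX IC.
rewrite -[LHS]/(\int[P]_(w in C) (cst 1%:E) w)%E integral_cst// mul1e.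
have A0 : P (~` A) = 0%E by rewrite probability_setC// A1 subee.
rewrite -[in LHS](setUIDK C A) measureU0//; first by rewrite setIC.
- exact: measurableI.
- exact: measurableD.
- by apply: subset_measure0 A0; [exact: measurableD|exact: measurableC|move=> w []].
Qed.

End threshold.

(** * The conditional right endpoint *)

Section endpoint.
Context d (T : measurableType d) (R : realType) (P : probability T R).
Variable X : nat -> T -> R.
Hypothesis mX : forall i, measurable_fun [set: T] (X i).
Hypothesis statX : strictly_stationary P X.
Variable Q : T -> \bar R.
Hypothesis Q_endpoint : is_cond_right_endpoint P (invariant_sets X) (X 0%N) Q.

Lemma ae_probability1 (A : set T) :
  measurable A -> P A = 1%E -> {ae P, forall w, A w}.
Proof.
move=> mA A1; have A0 : P (~` A) = 0%E by rewrite probability_setC// A1 subee.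
by apply/negligibleP => //; exact: measurableC.
Qed.

Lemma probability1_ae (A : set T) :
  measurable A -> {ae P, forall w, A w} -> P A = 1%E.
Proof.
move=> mA Aae; have mCA := measurableC mA.
have A0 : P (~` A) = 0%E by apply/negligibleP.
by rewrite -[A]setCK probability_setC// A0 sube0.
Qed.

Lemma measurable_le_threshold (f : T -> \bar R) :
  measurable_wrt (invariant_sets X) f -> measurable [set w | ((X 0%N w)%:E <= f w)%E].
Proof.
move=> mf; have [E mE EE] := borel_threshold mf.
rewrite (_ : [set w | _] = ~` (tail X 0 @^-1` E)).
  by apply: measurableC; exact: measurable_preimage_tail.
by rewrite EE; apply/seteqP; split => w /=; rewrite leNgt => /negP.
Qed.

Lemma ae_le_endpoint : {ae P, forall w, ((X 0%N w)%:E <= Q w)%E}.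
Proof.
have [mQ /cond_prob_eq1P + _] := Q_endpoint.
move=> /(_ mX (measurable_le_threshold mQ)).
by apply: ae_probability1; exact: measurable_le_threshold.
Qed.

(** On the invariant set [Z] where the threshold [f] is exceeded with lower
    density 0, the maximal inequality for the complementary event shows that
    [X 0] almost surely stays below [f]. Then [f] on [Z] and [Q] off [Z] is
    again an invariant upper bound of [X 0], so that [Q <= f] on [Z] by
    minimality of [Q]. *)
Lemma frequently_above_threshold (f : T -> \bar R) (E : set (nat -> R)) :
  measurable_wrt (invariant_sets X) f ->
  (forall w, (-oo < Q w)%E -> (f w < Q w)%E) ->
  borel_RN E -> tail X 0 @^-1` E = [set w | (f w < (X 0%N w)%:E)%E] ->
  {ae P, forall w, exists2 e : R, 0 < e &
    \forall n \near \oo, e * n%:R <= (visits E n (tail X 0 w))%:R}.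
Proof.
move=> mf fQ mE EE.
have mEC : borel_RN (~` E) by exact: (@measurableC _ (path_space R)).
(* Upper density of the complementary event above [1 - 1 / (j + 1)] for all
   [j] means lower density 0 of [E]. *)
pose Zj j := tail X 0 @^-1` upper_dense (~` E) (1 - j.+1%:R^-1).
pose Z := \bigcap_j Zj j.
have IZ : invariant_sets X Z.
  rewrite invariantE; apply: (@bigcapT_measurable _ (invariant_space X)) => j.
  by rewrite -invariantE; exact: invariant_upper_dense.
have mZ := measurable_invariant mX IZ.
have mE0 := measurable_preimage_tail mX 0%N mE.
have EZ0 : P (tail X 0 @^-1` E `&` Z) = 0%E.
  have mEZ := measurableI _ _ mE0 mZ.
  apply/eqP; rewrite eq_le measure_ge0 andbT.
  have [y Py] : exists y, P (tail X 0 @^-1` E `&` Z) = y%:E.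
    by exists (fine (P (tail X 0 @^-1` E `&` Z))); rewrite fineK// fin_num_measure.
  have [z Pz] : exists z, P Z = z%:E.
    by exists (fine (P Z)); rewrite fineK// fin_num_measure.
  have z1 : z <= 1 by rewrite -lee_fin -Pz probability_le1.
  have PEC : P (tail X 0 @^-1` (~` E) `&` Z) = (z - y)%:E.
    rewrite -preimage_setC setIC -setDE measureD//.
      by rewrite setIC EFinB -Pz -Py.
    by rewrite (le_lt_trans (probability_le1 _ _))// ltry.
  have yj j : y <= j.+1%:R^-1.
    have /(upper_dense_prob mX statX mEC IZ) : Z `<=` Zj j by move=> w; exact.
    rewrite PEC Pz -EFinM lee_fin.
    have : 0 <= j.+1%:R^-1 :> R by [].
    move: (_^-1) => r r0; nra.
  rewrite Py lee_fin leNgt; apply/negP => y0.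
  have [N _ /(_ N (leqnn N))/=] := near_infty_natSinv_lt (PosNum y0).
  by rewrite ltNge yj.
pose Q1 w := if w \in Z then f w else Q w.
have [mQ Q1P Qmin] := Q_endpoint.
have mQ1 : measurable_wrt (invariant_sets X) Q1.
  apply: measurable_fun_if => //.
  - apply: (measurable_fun_bool true); rewrite setTI.
    rewrite (_ : _ @^-1` _ = Z) -?invariantE//.
    by apply/seteqP; split => w /=; [move/set_mem|move/mem_set].
  - exact: measurable_funTS.
  - exact: measurable_funTS.
have mXQ1 := measurable_le_threshold mQ1.
have XQ1 : P [set w | ((X 0%N w)%:E <= Q1 w)%E] = 1%E.
  apply: probability1_ae => //; move: ae_le_endpoint.
  have : {ae P, forall w, ~ (tail X 0 @^-1` E `&` Z) w}.
    apply: negligibleS (_ : P.-negligible (tail X 0 @^-1` E `&` Z)).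
      by move=> w /= /contrapT.
    by apply/negligibleP => //; exact: measurableI.
  apply: filterS2 => w nEZ XQ; rewrite /= /Q1.
  have [/set_mem Zw|//] := boolP (w \in Z).
  by rewrite leNgt; apply/negP => fX; apply: nEZ; split => //; rewrite EE.
have /Qmin := (cond_prob_eq1P P mX mXQ1).2 XQ1 => /(_ mQ1) QQ1.
move: QQ1 ae_le_endpoint; apply: filterS2 => w QQ1 XQ.
have nZ : ~ Z w.
  move=> Zw; move: QQ1; rewrite /Q1 mem_set// leNgt fQ//.
  by rewrite (lt_le_trans (ltNyr (X 0%N w))).
have /existsNP[j /not_implyP[_ Zj_]] := nZ.
have e0 : 0 < j.+1%:R^-1 / 2 :> R by rewrite divr_gt0// invr_gt0.
exists (j.+1%:R^-1 / 2) => //.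
apply: filterS (not_upper_dense e0 Zj_) => n.
have := visits_setC E n (tail X 0 w) => /(congr1 (fun n => n%:R : R)).
rewrite natrD; move: (_^-1) => r; lra.
Qed.

End endpoint.

(** * Approximating an extended real from below *)

(** Unless [Q] is [-oo], these are real numbers below [Q] that tend to [Q]:
    finite also for [Q = +oo] thanks to the truncation at [m]. *)
Definition below (R : realType) (Q : \bar R) (m : nat) : \bar R :=
  (mine Q m%:R%:E - (m.+1%:R^-1)%:E)%E.

Lemma below_lt (R : realType) (Q : \bar R) m : (-oo < Q)%E -> (below Q m < Q)%E.
Proof.
rewrite /below; case: Q => [q| |]// _.
- rewrite lteBlDr// -EFin_min -EFinD lte_fin.
  by rewrite (le_lt_trans (_ : _ <= q)) ?ge_min ?lexx// ltrDl.
- by rewrite minye -EFinB ltry.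
Qed.

Lemma below_leS (R : realType) (Q : \bar R) m : (below Q m <= below Q m.+1)%E.
Proof.
apply: leeB; last by rewrite lee_fin lef_pV2 ?posrE// ler_nat.
rewrite le_min !ge_min lexx/=; apply/orP; right.
by rewrite lee_fin ler_nat.
Qed.

Lemma below_bigcap (R : realType) (Q : \bar R) (x : R) :
  (forall m, (below Q m < x%:E)%E) <-> (Q <= x%:E)%E.
Proof.
split=> [h|Qx m]; last first.
  case: (ltP -oo%E Q) => [/below_lt Qm|]; first exact: lt_le_trans (Qm m) Qx.
  by rewrite leeNy_eq => /eqP ->; rewrite /below minNye// ltNyr.
rewrite leNgt; apply/negP.
case: Q h => [q| |] h // xQ.
- move: xQ; rewrite lte_fin -subr_gt0 => xq.
  have := archi_boundP (normr_ge0 q); set N := Num.bound _ => qN.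
  have [K _ /(_ (maxn N K) (leq_maxr _ _))/= Kq] := near_infty_natSinv_lt (PosNum xq).
  have := h (maxn N K); rewrite /below -EFin_min -EFinB lte_fin.
  rewrite min_l; first by move: Kq; move: (_^-1) => r; lra.
  rewrite (le_trans (ler_norm q))// (le_trans (ltW qN))// ler_nat leq_maxl//.
- have := archi_boundP (addr_ge0 (normr_ge0 x) ler01); set N := Num.bound _ => xN.
  have := h N; rewrite /below minye -EFinB lte_fin.
  have : N.+1%:R^-1 <= 1 :> R by rewrite invf_le1// ler1n.
  have := ler_norm x.
  by move: (_^-1) => r; lra.
Qed.

(** * Counting around a high order statistic *)

Lemma order_stat_mem (R : realType) (x : nat -> R) (k n : nat) :
  (0 < k <= n)%N -> exists2 i, (i < n)%N & order_stat x k n = x i.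
Proof.
move=> /andP[k0 kn]; rewrite /order_stat.
have : nth 0 (sort <=%R [seq x i | i <- iota 0 n]) k.-1 \in
    sort <=%R [seq x i | i <- iota 0 n].
  by rewrite mem_nth// size_sort size_map size_iota prednK.
by rewrite mem_sort => /mapP[i]; rewrite mem_iota => /andP[_ ni] ->; exists i.
Qed.

Lemma count_gt_order_stat (R : realType) (x : nat -> R) (k n : nat) :
  (0 < k <= n)%N -> (\sum_(i < n) (order_stat x k n < x i)%R <= n - k)%N.
Proof.
move=> /andP[k0 kn]; rewrite /order_stat.
set s := sort _ _; set v := nth _ _ _.
have ss : size s = n by rewrite size_sort size_map size_iota.
have -> : (\sum_(i < n) (v < x i)%R)%N = count (fun y => v < y) s.
  rewrite count_sort count_map -sum1_count [RHS]big_mkcond/=.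
  rewrite -(big_mkord xpredT (fun i => nat_of_bool (v < x i))) /index_iota subn0.
  by apply: eq_bigr => i _ /=; case: ifP.
rewrite -(cat_take_drop k s) count_cat.
have -> : count (fun y => v < y) (take k s) = 0%N.
  apply/eqP; rewrite -leqn0 leqNgt -has_count; apply/hasPn => y /(nthP 0)[i].
  rewrite size_takel ?ss// => ik <-; rewrite nth_take// -leNgt.
  apply: (sorted_leq_nth le_trans lexx 0 (sort_sorted (@le_total _ _) _)).
  - by rewrite inE -/s ss (leq_trans ik).
  - by rewrite inE -/s ss prednK.
  - by rewrite -ltnS prednK.
by rewrite add0n (leq_trans (count_size _ _))// size_drop ss.
Qed.

Section near_count.
Context (R : realType) (a : R) (x : nat -> R) (k : nat -> nat) (Q : \bar R).
Context (p : R).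
Hypothesis k_bounds : forall n, (1 <= n)%N -> (1 <= k n <= n)%N.
Hypothesis k_lim : (k n)%:R / n%:R @[n --> \oo] --> (1 : R).
Local Notation count_gt y n := (\sum_(i < n) (y < (x i)%:E)%E)%N.

Hypothesis x_lt_Q : forall i, ((x i)%:E < Q)%E.
Hypothesis frequently_above : forall m, exists2 e : R, 0 < e &
  \forall n \near \oo, e * n%:R <= (count_gt (below Q m) n)%:R.

(** Otherwise the values above [below Q m], a positive proportion, would all be
    among the [n - k n] values above the order statistic. *)
Lemma order_stat_gt_below m :
  \forall n \near \oo, (below Q m < (order_stat x (k n) n)%:E)%E.
Proof.
have [e e0 eP] := frequently_above m.
have kle : \forall n \near \oo, 1 - e / 2 < (k n)%:R / n%:R.
  have e2 : 0 < e / 2 by lra.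
  move/cvgrPdist_lt : k_lim => /(_ _ e2); apply: filterS => n.
  by rewrite ltr_norml => /andP[]; lra.
near=> n.
have n0 : (0 < n)%N by near: n; exists 1%N.
have kn := k_bounds n0.
rewrite ltNge; apply/negP => h.
have c1 : (count_gt (below Q m) n <= \sum_(i < n) (order_stat x (k n) n < x i)%R)%N.
  apply: leq_sum => i _; case: (boolP (below Q m < (x i)%:E)%E) => //.
  by move=> /(le_lt_trans h); rewrite lte_fin => ->.
have c2 : (count_gt (below Q m) n)%:R <= (n - k n)%:R :> R.
  by rewrite ler_nat (leq_trans c1)// count_gt_order_stat.
have c3 : e * n%:R <= (count_gt (below Q m) n)%:R by near: n.
have c4 : 1 - e / 2 < (k n)%:R / n%:R by near: n.
move: c4; rewrite ltr_pdivlMr ?ltr0n// => c4.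
move: c2; rewrite natrB; last by case/andP: kn.
have : 0 < e * n%:R by rewrite mulr_gt0// ltr0n.
lra.
Unshelve. all: by end_near. Qed.

Hypothesis count_Q : forall e : R, 0 < e -> exists m,
  \forall n \near \oo, (count_gt (below Q m) n)%:R <= e * n%:R.
Hypothesis count_Qa_le : forall e : R, 0 < e -> exists m,
  \forall n \near \oo, (count_gt (below Q m - a%:E)%E n)%:R <= (p + e) * n%:R.
Hypothesis count_Qa_ge : forall e : R, 0 < e ->
  \forall n \near \oo, (p - e) * n%:R <= (count_gt (Q - a%:E)%E n)%:R.

(** A value above [Q - a] is counted unless it is at least the order statistic,
    and hence above [below Q m]. *)
Lemma near_count_cvg :
  (near_count x (k n) n a)%:R / n%:R @[n --> \oo] --> p.
Proof.
apply/cvgrPdist_le => e e0.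
have e2 : 0 < e / 2 by lra.
have [m1 m1P] := count_Q e2.
have [m2 m2P] := count_Qa_le e0.
have g1 := order_stat_gt_below m1; have g2 := order_stat_gt_below m2.
have ge := count_Qa_ge e2.
near=> n.
have n0 : (0 < n)%N by near: n; exists 1%N.
have v1 : (below Q m1 < (order_stat x (k n) n)%:E)%E by near: n.
have v2 : (below Q m2 < (order_stat x (k n) n)%:E)%E by near: n.
have h1 : (count_gt (below Q m1) n)%:R <= e / 2 * n%:R by near: n.
have h2 : (count_gt (below Q m2 - a%:E)%E n)%:R <= (p + e) * n%:R by near: n.
have h3 : (p - e / 2) * n%:R <= (count_gt (Q - a%:E)%E n)%:R by near: n.
have vQ : ((order_stat x (k n) n)%:E < Q)%E.
  by have [j _ ->] := order_stat_mem x (k_bounds n0).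
set v := order_stat x (k n) n in v1 v2 vQ.
have up : (near_count x (k n) n a <= count_gt (below Q m2 - a%:E)%E n)%N.
  apply: leq_sum => i _; rewrite -/v.
  case: (boolP (v - a < x i < v)) => // /andP[h _].
  suff -> : (below Q m2 - a%:E < (x i)%:E)%E by [].
  by rewrite lteBlDr//; apply: (lt_trans v2); rewrite -EFinD lte_fin; lra.
have lo : (count_gt (Q - a%:E)%E n <=
    near_count x (k n) n a + count_gt (below Q m1) n)%N.
  rewrite -big_split/=; apply: leq_sum => i _; rewrite -/v.
  case: (boolP (Q - a%:E < (x i)%:E)%E) => // h.
  have -> : v - a < x i.
    by move: h; rewrite lteBlDr// => /(lt_trans vQ); rewrite -EFinD lte_fin; lra.
  have [//|vx] := boolP (x i < v).
  by rewrite (lt_le_trans v1)// lee_fin leNgt.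
have n0R : 0 < n%:R :> R by rewrite ltr0n.
rewrite distrC ler_distl; apply/andP; split.
  rewrite ler_pdivlMr//.
  by move: lo; rewrite -(ler_nat R) natrD; lra.
by rewrite ler_pdivrMr// (le_trans _ h2)// ler_nat.
Unshelve. all: by end_near. Qed.

End near_count.

(** * The theorem *)

Unset Implicit Arguments.

Theorem theorem3p3 (R : realType) (d : measure_display) (T : measurableType d)
    (P : probability T R) (a : R) (a_gt0 : 0 < a)
    (X : nat -> {RV P >-> R}) (X_stationary : strictly_stationary P X)
    (k : nat -> nat)
    (k_bounds : forall n : nat, (1 <= n)%N -> (1 <= k n <= n)%N)
    (k_lim : (k n)%:R / n%:R @[n --> \oo] --> (1 : R))
    (* a version of gamma_1(X_1 | I^X) *)
    (Q : T -> \bar R)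
    (Q_endpoint : is_cond_right_endpoint P (invariant_sets X) (X 0%N) Q)
    (X_neq_Q : P [set w | (X 0%N w)%:E = Q w] = 0%E)
    (X_neq_Qa : P [set w | (X 0%N w)%:E = (Q w - a%:E)%E] = 0%E)
    (* a version of P(X_1 > gamma_1(X_1 | I^X) - a | I^X) *)
    (p : T -> R)
    (p_version : is_cond_prob P (invariant_sets X)
                   [set w | ((X 0%N w)%:E > Q w - a%:E)%E] p) :
  {ae P, forall w,
    (near_count (fun i => X i w) (k n) n a)%:R / n%:R @[n --> \oo] --> p w}.
Proof.
have mX i : measurable_fun [set: T] (X i) by exact: measurable_funPT.
have [mQ _ _] := Q_endpoint.
have mbelow m : measurable_wrt (invariant_sets X) (fun w => below (Q w) m).
  apply: emeasurable_funB; last exact: measurable_cst.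
  by apply: measurable_mine => //; exact: measurable_cst.
have mbelow_a m : measurable_wrt (invariant_sets X) (fun w => below (Q w) m - a%:E)%E.
  by apply: emeasurable_funB; [exact: mbelow|exact: measurable_cst].
have mQa : measurable_wrt (invariant_sets X) (fun w => Q w - a%:E)%E.
  by apply: emeasurable_funB => //; exact: measurable_cst.
have threshold (f : T -> \bar R) : measurable_wrt (invariant_sets X) f -> exists E,
    borel_RN E /\ forall i, tail X i @^-1` E = [set w | (f w < (X i w)%:E)%E].
  by move=> /borel_threshold[E mE EE]; exists E.
have [E EP] := choice (fun m => threshold _ (mbelow m)).
have [F FP] := choice (fun m => threshold _ (mbelow_a m)).
have [D [mD DE]] := threshold _ mQa.
have [U [mU UE]] := threshold _ mQ.
(* [E], [F], [D] and [U] describe the events [X i > below Q m],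
   [X i > below Q m - a], [X i > Q - a] and [X i > Q]. *)
have capE i : tail X i @^-1` (\bigcap_m E m) = [set w | (Q w <= (X i w)%:E)%E].
  rewrite preimage_bigcap; apply/seteqP; split=> w /=.
    by move=> h; apply/below_bigcap => m; have := h m Logic.I; rewrite (EP m).2.
  by move=> /below_bigcap h m _; rewrite (EP m).2; exact: h.
have capF i : tail X i @^-1` (\bigcap_m F m) = [set w | (Q w - a%:E <= (X i w)%:E)%E].
  rewrite preimage_bigcap; apply/seteqP; split=> w h.
    suff : (Q w - a%:E <= (X i w)%:E)%E by [].
    rewrite leeBlDr// -EFinD; apply/below_bigcap => m.
    suff : (below (Q w) m - a%:E < (X i w)%:E)%E by rewrite lteBlDr.
    by have := h m Logic.I; rewrite (FP m).2.
  have {h} : (Q w - a%:E <= (X i w)%:E)%E by [].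
  rewrite leeBlDr// -EFinD => /below_bigcap h m _; rewrite (FP m).2.
  suff : (below (Q w) m - a%:E < (X i w)%:E)%E by [].
  by rewrite lteBlDr//; exact: h.
have mcapE : borel_RN (\bigcap_m E m).
  by apply: (@bigcapT_measurable _ (path_space R)) => m; exact: (EP m).1.
have mcapF : borel_RN (\bigcap_m F m).
  by apply: (@bigcapT_measurable _ (path_space R)) => m; exact: (FP m).1.
have mtail i B : borel_RN B -> measurable (tail X i @^-1` B).
  exact: measurable_preimage_tail.
have Q_le_X0 : P (tail X 0 @^-1` (\bigcap_m E m)) = 0%E.
  have diff : (tail X 0 @^-1` (\bigcap_m E m)) `\` (tail X 0 @^-1` U) =
      [set w | (X 0%N w)%:E = Q w].
    rewrite capE UE; apply/seteqP; split => w /=.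
      by move=> [QX /negP]; rewrite -leNgt => XQ; apply/le_anti/andP.
    by move=> ->; rewrite lexx ltxx.
  apply: measure_negligible; first exact: mtail.
  apply: negligibleS (negligibleU (_ : P.-negligible (tail X 0 @^-1` U))
    (_ : P.-negligible [set w | (X 0%N w)%:E = Q w])).
  - move=> w; rewrite -diff => h.
    by have [Uw|nUw] := pselect ((tail X 0 @^-1` U) w); [left|right].
  - apply: negligibleS (ae_le_endpoint mX Q_endpoint) => w.
    by rewrite UE /= ltNge => /negP.
  - by apply/negligibleP => //; rewrite -diff; apply: measurableD; exact: mtail.
have X_lt_Q : {ae P, forall w i, ((X i w)%:E < Q w)%E}.
  apply: ae_foralln => i.
  apply: negligibleS (_ : P.-negligible (tail X i @^-1` (\bigcap_m E m))).
    by move=> w; rewrite capE /= => /negP; rewrite -leNgt.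
  apply/negligibleP; first exact: mtail.
  exact: etrans (X_stationary i _ mcapE) Q_le_X0.
have above : {ae P, forall w m, exists2 e : R, 0 < e &
    \forall n \near \oo, e * n%:R <= (visits (E m) n (tail X 0 w))%:R}.
  apply: ae_foralln => m.
  apply: (frequently_above_threshold mX X_stationary Q_endpoint (mbelow m)).
  - by move=> w; exact: below_lt.
  - exact: (EP m).1.
  - exact: (EP m).2.
have near_Q : {ae P, forall w (e : R), 0 < e -> exists m,
    \forall n \near \oo, (visits (E m) n (tail X 0 w))%:R <= (0 + e) * n%:R}.
  apply: (eventually_visits_le mX X_stationary (E := E) (p := fun=> 0)).
  - by move=> m; exact: (EP m).1.
  - move=> m w; rewrite (EP m).2 (EP m.+1).2 /=; exact: le_lt_trans (below_leS _ _).
  - apply: (is_cond_prob_null_superset mX measurable0) => //; first exact: mtail.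
    + by rewrite setD0.
    + exact: is_cond_prob_set0.
have near_Qa : {ae P, forall w (e : R), 0 < e -> exists m,
    \forall n \near \oo, (visits (F m) n (tail X 0 w))%:R <= (p w + e) * n%:R}.
  apply: (eventually_visits_le mX X_stationary).
  - by move=> m; exact: (FP m).1.
  - move=> m w; rewrite (FP m).2 (FP m.+1).2 /=.
    by apply: le_lt_trans; rewrite leeD2r// below_leS.
  - apply: (is_cond_prob_null_superset mX) p_version.
    + by rewrite -DE; exact: mtail.
    + exact: mtail.
    + by move=> w; rewrite capF /= => /ltW.
    + rewrite -[RHS]X_neq_Qa; congr (P _); rewrite capF; apply/seteqP; split => w /=.
        by move=> [QX /negP]; rewrite -leNgt => XQ; apply/le_anti/andP.
      by move=> ->; rewrite lexx ltxx.
have above_Qa : {ae P, forall w (e : R), 0 < e -> exists m : nat,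
    \forall n \near \oo, (visits (~` D) n (tail X 0 w))%:R <= (1 - p w + e) * n%:R}.
  apply: (eventually_visits_le mX X_stationary (E := fun=> ~` D) (p := fun w => 1 - p w)).
  - by move=> _; exact: (@measurableC _ (path_space R)).
  - by move=> _ w.
  - rewrite bigcap_const// -preimage_setC.
    apply: (is_cond_prob_setC mX); first exact: mtail.
    by rewrite DE.
apply: filterS3 (filterI X_lt_Q above) (filterI near_Q near_Qa) above_Qa.
move=> w [XQ ab] [nQ nQa] aQa.
have visE m n : visits (E m) n (tail X 0 w) =
  (\sum_(i < n) (below (Q w) m < (X i w)%:E)%E)%N.
  exact: visits_threshold (EP m).2.
have visF m n : visits (F m) n (tail X 0 w) =
  (\sum_(i < n) (below (Q w) m - a%:E < (X i w)%:E)%E)%N.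
  exact: (visits_threshold _ _ (FP m).2).
have visD n : visits D n (tail X 0 w) =
  (\sum_(i < n) (Q w - a%:E < (X i w)%:E)%E)%N.
  exact: (visits_threshold _ _ DE).
apply: (near_count_cvg k_bounds k_lim XQ) => [m|e e0|e e0|e e0].
- have [e e0 eP] := ab m; exists e => //.
  by apply: filterS eP => n; rewrite visE.
- have [m mP] := nQ e e0; exists m.
  by apply: filterS mP => n; rewrite visE add0r.
- have [m mP] := nQa e e0; exists m.
  by apply: filterS mP => n; rewrite visF.
- have [m] := aQa e e0; apply: filterS => n.
  have := visits_setC D n (tail X 0 w) => /(congr1 (fun n => n%:R : R)).
  by rewrite natrD visD; lra.
Qed.
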